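(* Let $\mathcal{O}_1,\mathcal{O}_2:\mathscr{L}\to2^{\mathscr{D}}$ be two optimality operators on the same loss space $\mathscr{L}$ and decision-rule class $\mathscr{D}$. If $\mathcal{O}_1\succeq\mathcal{O}_2$, meaning $\mathcal{O}_1(L)\subseteq\mathcal{O}_2(L)$ for every $L\in\mathscr{L}$, then every edge of $G_{\mathcal{O}_1}$ is also an edge of $G_{\mathcal{O}_2}$. Consequently, every identification component under $\mathcal{O}_1$ is contained in an identification component under $\mathcal{O}_2$: the partition of $\mathscr{L}$ induced by $\mathcal{O}_2$ coarsens the partition induced by $\mathcal{O}_1$.
   Context: An optimality operator is an arbitrary set-valued map from $\mathscr{L}$ to subsets of $\mathscr{D}$. The identification graph $G_{\mathcal{O}}$ of an operator $\mathcal{O}$ has vertex set $\mathscr{L}$ and connects $L$ and $L'$ whenever $\mathcal{O}(L)\cap\mathcal{O}(L')\ne\emptyset$. The identification components under $\mathcal{O}$ are the connected components of $G_{\mathcal{O}}$; they partition $\mathscr{L}$. *)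

(* Defs.v *)
From mathcomp Require Import all_boot classical_sets.
From Stdlib Require Import Relation_Operators.
Set Implicit Arguments.
Unset Strict Implicit.
Unset Printing Implicit Defensive.
Local Open Scope classical_set_scope.

Definition optimality_operator (L D : Type) := L -> set D.

Definition stronger (L D : Type) (O1 O2 : optimality_operator L D) : Prop :=
  forall l : L, O1 l `<=` O2 l.

(* A loop at l is present exactly when O l is nonempty; loops do not affect
   connected components. *)
Definition id_edge (L D : Type) (O : optimality_operator L D) (l l' : L) : Prop :=
  O l `&` O l' !=set0.

(* Existence of a finite, possibly trivial, walk from l to l'; since id_edge is
   symmetric, the reflexive-transitive closure is graph connectedness. *)
Definition id_connected (L D : Type) (O : optimality_operator L D) (l l' : L) :
  Prop := clos_refl_trans L (id_edge O) l l'.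

Definition id_components (L D : Type) (O : optimality_operator L D) :
    set (set L) :=
  [set C | exists l : L, C = [set l' | id_connected O l l']].

(* P and Q are partitions of the whole type T and P is coarser than (or equal
   to) Q. *)
Definition coarsens (T : Type) (P Q : set (set T)) : Prop :=
  [/\ partition P id [set: T], partition Q id [set: T] &
      forall B, Q B -> exists2 C, P C & B `<=` C].

(* Main.v *)
Require Import Defs.
From mathcomp Require Import all_boot classical_sets.
From Stdlib Require Import Relation_Operators.
Local Open Scope classical_set_scope.

(** A decision rule witnessing an edge for [O1] still witnesses it for the larger sets of [O2], so
    edges persist, and hence so do walks, edge by edge ([id_connected_stronger]). The [O1]-component
    of a loss therefore lies in its [O2]-component. Coarsening also needs both families to be
    partitions: they consist of the classes of an equivalence relation
    ([id_components_partition]). *)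

Lemma id_edge_sym (L D : Type) (O : optimality_operator L D) (l l' : L) :
  id_edge O l l' -> id_edge O l' l.
Proof. by rewrite /id_edge setIC. Qed.

Lemma id_edge_stronger (L D : Type) (O1 O2 : optimality_operator L D) :
  stronger O1 O2 -> forall l l' : L, id_edge O1 l l' -> id_edge O2 l l'.
Proof. by move=> h l l' [d [Od Od']]; exists d; split; apply: h. Qed.

(** Reverse the walk: each edge is symmetric, and concatenated pieces are swapped. Symmetry is the
    one equivalence axiom that the closure does not supply by itself. *)
Lemma id_connected_sym (L D : Type) (O : optimality_operator L D) (l l' : L) :
  id_connected O l l' -> id_connected O l' l.
Proof.
elim=> [x y /(id_edge_sym _ _ _ _ _)|x|x y z _ yx _ zy]; first exact: rt_step.
- exact: rt_refl.
- exact: rt_trans zy yx.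
Qed.

Lemma id_connected_stronger (L D : Type) (O1 O2 : optimality_operator L D) :
  stronger O1 O2 ->
  forall l l' : L, id_connected O1 l l' -> id_connected O2 l l'.
Proof.
move=> h l l'; elim=> [x y /(id_edge_stronger _ _ _ _ h)|x|x y z _ xy _ yz].
- exact: rt_step.
- exact: rt_refl.
- exact: rt_trans xy yz.
Qed.

Lemma id_components_partition (L D : Type) (O : optimality_operator L D) :
  partition (id_components O) id [set: L].
Proof.
split.
- apply/seteqP; split=> [//|l _].
  exists [set l' | id_connected O l l']; first by exists l.
  exact: rt_refl.
- move=> _ _ [a ->] [b ->] [x [ax bx]].
  (* Two components sharing [x] have connected base points: go from [a] to [x], then back along the
     walk from [b]. Prefixing this walk or its reverse then gives both inclusions. *)
  have ab : id_connected O a b := rt_trans _ _ _ _ _ ax (id_connected_sym _ _ _ _ _ bx).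
  apply/seteqP; split=> y.
  + exact: rt_trans (id_connected_sym _ _ _ _ _ ab).
  + exact: rt_trans ab.
- by move=> _ [l ->]; exists l; apply: rt_refl.
Qed.

Lemma id_components_stronger (L D : Type) (O1 O2 : optimality_operator L D) :
  stronger O1 O2 ->
  forall C1 : set L, id_components O1 C1 ->
    exists2 C2 : set L, id_components O2 C2 & C1 `<=` C2.
Proof.
(* Keep the base point [l] and take its component under [O2]. *)
move=> h _ [l ->]; exists [set l' | id_connected O2 l l']; first by exists l.
by move=> l'; apply: id_connected_stronger.
Qed.

Theorem proposition5 (L D : Type) (O1 O2 : optimality_operator L D)
    (h : stronger O1 O2) :
  [/\ forall l l' : L, id_edge O1 l l' -> id_edge O2 l l',
      forall C1 : set L, id_components O1 C1 ->
        exists2 C2 : set L, id_components O2 C2 & C1 `<=` C2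
    & coarsens (id_components O2) (id_components O1)].
Proof.
split; [exact: id_edge_stronger | exact: id_components_stronger |].
split; [exact: id_components_partition | exact: id_components_partition |].
exact: id_components_stronger.
Qed.
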